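(* Let $a_1>2$ be a given integer. Then there is a positive constant $c_1$ depending only on $a_1$ such that $$\limsup_{\substack{a_2\to\infty\\ \gcd(a_1,a_2)=1}}\frac{G_{a_1,a_2}}{a_2\log a_2}>c_1.$$
   Context: For coprime positive integers $a_1,a_2$, $G_{a_1,a_2}$ denotes the least integer such that every integer $n>G_{a_1,a_2}$ can be written as $n=a_1x_1+a_2x_2$ with $x_1,x_2\in\mathbb{Z}_{\ge0}$ and $\gcd(x_1,x_2)=1$ (this is known to be finite). *)

(* Defs.v *)
From HB Require Import structures.
From mathcomp Require Import all_boot all_order all_algebra.
From mathcomp Require Import all_classical all_reals all_analysis.

Set Implicit Arguments.
Unset Strict Implicit.
Unset Printing Implicit Defensive.

Import Order.TTheory GRing.Theory Num.Theory.

Local Open Scope classical_set_scope.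
Local Open Scope ring_scope.

Definition primitively_representable (a1 a2 : nat) (n : int) : Prop :=
  exists x1 x2 : nat,
    coprime x1 x2 /\ n = a1%:Z * x1%:Z + a2%:Z * x2%:Z.

Definition all_above_representable (a1 a2 : nat) (g : int) : Prop :=
  forall n : int, g < n -> primitively_representable a1 a2 n.

Definition is_least_bound (a1 a2 : nat) (g : int) : Prop :=
  all_above_representable a1 a2 g /\
  forall g' : int, all_above_representable a1 a2 g' -> g <= g'.

(* The default value 0 is returned only when no least integer exists; this
   does not happen for coprime positive a1 and a2. *)
Definition G (a1 a2 : nat) : int :=
  xget (0 : int) [set g | is_least_bound a1 a2 g].

(* Main.v *)
Require Import Defs.
From HB Require Import structures.
From mathcomp Require Import all_boot all_order all_algebra.
From mathcomp Require Import all_classical all_reals all_analysis.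
From mathcomp Require Import zify ring lra.

Import Order.TTheory GRing.Theory Num.Theory.

Local Open Scope classical_set_scope.
Local Open Scope ring_scope.

(** Lower bound.  Let [X] be a power of 2 and let [n] be a multiple, coprime to
    [a1], of every prime [p <= X] with [p] not dividing [a1].  Choose [a2] close
    to [n / X] with [a2 = - n] modulo [a1].  If [n = a1 x1 + a2 x2], then
    [x2 = -1] modulo [a1] and [x2 <= X]; as [a1 > 2] this forces [x2 > 1], so
    [x2] has a prime factor [p <= X] not dividing [a1].  Then [p] divides [n],
    hence also [x1].  Thus [G a1 a2 >= n], about [a2 X], while Chebyshev's bound
    on the product of the primes up to [X] lets us take [ln n = O(X)].

    Since [G] has a default value, its finiteness also has to be proved: a
    unimodular substitution turns a coprime representation of [n] into an
    integer coprime to [n] in an interval of length [n / (a1 a2)], which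
    Legendre's sieve provides, its error term being exponential in the number
    of prime factors of [n] and hence [O(sqrt n)]. *)

(** * Products of distinct primes and the number of prime factors *)

Lemma prod_primes_dvd (s : seq nat) (m : nat) :
  uniq s -> all prime s -> all (fun p => (p %| m)%N) s ->
  (\prod_(p <- s) p %| m)%N.
Proof.
elim: s => [|q s IH] /=; first by rewrite big_nil dvd1n.
move=> /andP[qs us] /andP[qP sP] /andP[qm sm]; rewrite big_cons Gauss_dvd.
  by rewrite qm IH.
rewrite big_seq; apply: (big_ind (coprime q)); first exact: coprimen1.
  by move=> x y; rewrite coprimeMr => -> ->.
move=> p ps; rewrite prime_coprime // dvdn_prime2 ?(allP sP _ ps) //.
by apply: contraNneq qs => ->.
Qed.

(** At most [b] prime factors lie below [b], which [b ^ b] absorbs; the others are at least [b], and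
    the product of all of them is at most [n]. *)
Lemma primes_exp_size_bound (b n : nat) : (0 < n)%N ->
  (b ^ size (primes n) <= b ^ b * n)%N.
Proof.
move=> n0; case: b => [|b].
  by case: (size _) => [|k]; rewrite ?expn0 ?exp0n //; lia.
set s := primes n.
have ple : (\prod_(p <- s) p <= n)%N.
  apply/dvdn_leq/prod_primes_dvd => //; rewrite ?primes_uniq ?all_prime_primes //.
  by apply/allP => p; rewrite mem_primes => /and3P[].
have small : (count (fun p => p < b.+1) s <= b.+1)%N.
  rewrite -size_filter -[X in (_ <= X)%N](size_iota 0 b.+1).
  apply: uniq_leq_size; first by rewrite filter_uniq ?primes_uniq.
  by move=> p; rewrite mem_filter mem_iota => /andP[].
apply: leq_trans (leq_mul (leq_pexp2l (ltn0Sn b) small) ple).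
have: all (leq 1) s.
  by apply/allP => p; rewrite mem_primes => /and3P[/prime_gt0].
elim: (s) => [|p r IH] /=; first by rewrite big_nil.
move=> /andP[p0 /IH{}IH]; rewrite big_cons expnS.
case: (ltnP p b.+1) => pb; rewrite ?add1n ?add0n ?expnS.
  rewrite -mulnA leq_mul2l (leq_trans IH) ?orbT // leq_mul2l.
  by rewrite leq_pmull ?orbT.
by rewrite mulnCA leq_mul.
Qed.

(** * Legendre's sieve *)

Definition sieve_count (s : seq nat) (x : nat) : nat :=
  count (fun w => all (fun p => ~~ (p %| w)%N) s) (iota 0 x).

(** Rounded up because the multiples of [q] in [[0, x)], which it counts for [q > 0], include 0. *)
Definition ceil_div (x q : nat) : nat := ((x + q.-1) %/ q)%N.

Lemma ceil_divS (x q : nat) : (0 < q)%N ->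
  ceil_div x.+1 q = (ceil_div x q + (q %| x))%N.
Proof.
move=> q0; rewrite /ceil_div addSnnS prednK //.
rewrite divnDr ?dvdnn // divnn q0 addn1.
case: (boolP (q %| x)%N) => [/dvdnP[k ->]|nqx].
  by rewrite mulnK // divnMDl // divn_small ?addn0 ?addn1 ?prednK.
rewrite addn0 {2}(divn_eq x q) -addnA divnMDl // -addn1; congr addn.
have r0 : (0 < x %% q)%N by rewrite lt0n.
have rq := ltn_pmod x q0.
have -> : (x %% q + q.-1 = 1 * q + (x %% q).-1)%N by lia.
by rewrite divnMDl // divn_small ?addn0 //; lia.
Qed.

(** Legendre's recursion: the multiples of [q] below [x] are [k * q] with [k < ceil_div x q], and
    [k * q] survives the sieve by [s] exactly when [k] does, because [q] is a prime outside [s]. *)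
Lemma sieve_count_cons (q : nat) (s : seq nat) (x : nat) :
  prime q -> q \notin s -> all prime s ->
  sieve_count s x = (sieve_count (q :: s) x + sieve_count s (ceil_div x q))%N.
Proof.
move=> qP qs sP; have q0 := prime_gt0 qP.
elim: x => [|x IH]; first by rewrite /ceil_div add0n divn_small ?ltn_predL.
have countS t y : sieve_count t y.+1 =
    (sieve_count t y + all (fun p => ~~ (p %| y)%N) t)%N.
  by rewrite /sieve_count -addn1 iotaD count_cat /= addn0.
rewrite !countS IH ceil_divS //.
case: (boolP (q %| x)%N) => [/dvdnP[k ->]|nqx] /=; last first.
  by rewrite nqx addn0; lia.
have -> : ceil_div (k * q) q = k.
  by rewrite /ceil_div divnMDl // divn_small ?addn0 ?ltn_predL.
rewrite addn1 countS dvdn_mull //= addn0 -addnA; congr (_ + (_ + nat_of_bool _))%N.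
apply: eq_in_all => p ps; rewrite Euclid_dvdM ?(allP sP) //.
rewrite (dvdn_prime2 (allP sP _ ps) qP).
case: eqVneq => [pq|_]; last by rewrite ?orbF.
by move: qs; rewrite -pq ps.
Qed.

Definition sieve_density (s : seq nat) : rat := \prod_(p <- s) (1 - p%:R^-1).

Lemma sieve_density_bounds (s : seq nat) : all prime s ->
  2^-1 ^+ size s <= sieve_density s <= 1.
Proof.
rewrite /sieve_density; elim: s => [|q s IH] /=.
  by rewrite big_nil expr0 lexx.
move=> /andP[qP /IH /andP[lo hi]]; rewrite big_cons exprS.
have q2 : 2 <= q%:R :> rat by rewrite (ler_nat _ 2) prime_gt1.
have qi : q%:R^-1 <= 2^-1 :> rat by rewrite lef_pV2 ?posrE //; lra.
have qi0 : 0 <= q%:R^-1 :> rat by rewrite invr_ge0; lra.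
have pos : (0 : rat) <= 2^-1 ^+ size s by rewrite exprn_ge0 // invr_ge0.
apply/andP; split; first by apply: ler_pM => //; lra.
by rewrite -[X in _ <= X]mulr1 ler_pM //; lra.
Qed.

(** Each prime doubles the error and adds at most 1 for rounding [x / q] up:
    [2 * (2 ^ k - 1) + 1 = 2 ^ (k + 1) - 1]. *)
Lemma sieve_count_error (s : seq nat) (x : nat) : uniq s -> all prime s ->
  `|(sieve_count s x)%:R - x%:R * sieve_density s| <= 2 ^+ size s - 1.
Proof.
elim: s x => [|q s IH] x /=.
  rewrite /sieve_density big_nil /sieve_count count_predT size_iota.
  by rewrite expr0 mulr1 !subrr normr0.
move=> /andP[qs us] /andP[qP sP]; have q0 := prime_gt0 qP.
have := sieve_count_cons q s x qP qs sP.
move=> /(congr1 (fun k => k%:R : rat)); rewrite natrD => Ecount.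
have := IH x us sP; have := IH (ceil_div x q) us sP.
have /andP[dlo dhi] := sieve_density_bounds s sP.
have d0 : 0 <= sieve_density s.
  by apply: le_trans dlo; rewrite exprn_ge0 // invr_ge0.
have -> : sieve_density (q :: s) = (1 - q%:R^-1) * sieve_density s.
  by rewrite /sieve_density big_cons.
have qr0 : 0 < q%:R :> rat by rewrite ltr0n.
have e0 : 0 <= (ceil_div x q)%:R - x%:R / q%:R :> rat.
  rewrite subr_ge0 ler_pdivrMr // -natrM ler_nat.
  by have := ltn_ceil (x + q.-1) q0; rewrite -/(ceil_div x q); lia.
have e1 : (ceil_div x q)%:R - x%:R / q%:R <= 1 :> rat.
  rewrite lerBlDr.
  have -> : 1 + x%:R / q%:R = (x + q)%:R / q%:R :> rat.
    by rewrite natrD mulrDl divff ?gt_eqF // addrC.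
  rewrite ler_pdivlMr // -natrM ler_nat.
  by have := leq_divM (x + q.-1) q; rewrite -/(ceil_div x q); lia.
set e := _ - _ / _ in e0 e1.
have de0 : 0 <= e * sieve_density s by rewrite mulr_ge0.
have de1 : e * sieve_density s <= 1.
  by rewrite -[X in _ <= X]mulr1 ler_pM.
have key : x%:R * ((1 - q%:R^-1) * sieve_density s) =
  x%:R * sieve_density s - (ceil_div x q)%:R * sieve_density s
   + e * sieve_density s by rewrite /e; ring.
rewrite key exprS !ler_norml => /andP[h1 h2] /andP[h3 h4].
by apply/andP; split; lra.
Qed.

Lemma coprime_in_interval (n x y : nat) : (0 < n)%N ->
  (x + 2 * 4 ^ size (primes n) <= y)%N ->
  exists w, [/\ (x <= w)%N, (w < y)%N & coprime w n].
Proof.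
move=> n0 xy; set s := primes n in xy.
have sP : all prime s := all_prime_primes n.
have us : uniq s := primes_uniq n.
have lt_count : (sieve_count s x < sieve_count s y)%N.
  rewrite -(ltr_nat rat).
  have := sieve_count_error s x us sP; have := sieve_count_error s y us sP.
  have /andP[dlo _] := sieve_density_bounds s sP.
  rewrite !ler_norml => /andP[h1 _] /andP[_ h2].
  have gap : 2 * 4 ^+ size s <= y%:R - x%:R :> rat.
    by rewrite lerBrDl -natrX -natrM -natrD ler_nat.
  (* The main term on the interval thus exceeds the two errors, together at most
     [2 * (2 ^ size s - 1)]. *)
  have : 2 * 2 ^+ size s <= (y%:R - x%:R) * sieve_density s.
    have -> : 2 * 2 ^+ size s = (2 * 4 ^+ size s) * 2^-1 ^+ size s :> rat.
      by rewrite -mulrA -exprMn; congr (_ * _ ^+ _); lra.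
    by apply: ler_pM; rewrite ?mulr_ge0 ?exprn_ge0 ?invr_ge0.
  by rewrite mulrBl; lra.
have le_xy : (x <= y)%N by lia.
move: lt_count; rewrite -{1}(subnKC le_xy) /sieve_count iotaD count_cat.
rewrite -[X in (X < _)%N]addn0 ltn_add2l -has_count add0n => /hasP[w].
rewrite mem_iota subnKC // => /andP[xw wy] /allP good.
exists w; split => //; apply: contraT => ncop.
have g1 : (1 < gcdn w n)%N by rewrite ltn_neqAle eq_sym ncop gcdn_gt0 n0 orbT.
have := pdiv_dvd (gcdn w n); rewrite dvdn_gcd => /andP[dw dn].
have /good : pdiv (gcdn w n) \in s by rewrite mem_primes pdiv_prime ?n0.
by rewrite dw.
Qed.

(** As [16 ^ size (primes n)] is at most a constant times [n], its square root [4 ^ size (primes n)]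
    is [O(sqrt n)]. *)
Lemma four_exp_omega_small (D : nat) : exists N : nat, forall n : nat,
  (N < n)%N -> (D * 4 ^ size (primes n) <= n)%N.
Proof.
exists (D ^ 2 * 16 ^ 16)%N => n; have := primes_exp_size_bound 16 n.
move: (16 ^ 16)%N => C bound lt_n; have /bound{}bound : (0 < n)%N by lia.
rewrite leqNgt; apply/negP => lt_nD.
have : (n * n < D ^ 2 * 16 ^ size (primes n))%N.
  have -> : (D ^ 2 * 16 ^ size (primes n) =
    D * 4 ^ size (primes n) * (D * 4 ^ size (primes n)))%N.
    by rewrite mulnACA -expnMn mulnn.
  exact: ltn_mul.
apply/negP; rewrite -leqNgt; apply: leq_trans (leq_mul (leqnn _) bound) _.
by rewrite mulnA leq_mul // ltnW.
Qed.

(** * Coprime representations of all large integers *)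

Lemma coprime_of_combinations (a b c d x y : nat) :
  coprime (a * x + b * y) (c * x + d * y) -> coprime x y.
Proof.
move=> /eqP co; rewrite /coprime -dvdn1 -co dvdn_gcd.
by rewrite !dvdn_add ?dvdn_mull ?dvdn_gcdl ?dvdn_gcdr.
Qed.

(* With [v a - u b = 1], the map [(x, y) |-> (a x + b y, u x + v y)] is
   unimodular, so it suffices to find [w] coprime to [n] with
   [u n / a <= w <= v n / b], an interval of length [n / (a b)]. *)
Lemma coprime_representation_eventually (a b : nat) :
  (0 < a)%N -> (0 < b)%N -> coprime a b ->
  exists N : nat, forall n : nat, (N < n)%N ->
  exists x y : nat, coprime x y /\ n = (a * x + b * y)%N.
Proof.
move=> a0 b0 /eqP cab.
(* The factor 4 covers the sieve length and a rounding loss of 2: [2 * 4 ^ k + 2 <= 4 * 4 ^ k]. *)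
have [N HN] := four_exp_omega_small (4 * (a * b)); exists N => n /[dup] Nn /HN big.
have n0 : (0 < n)%N by lia.
case: (egcdnP b a0) => v u; rewrite cab => bez _.
set k := size (primes n) in big.
have k0 : (0 < 4 ^ k)%N by rewrite expn_gt0.
have hx := leq_divM (u * n) a; have hx' := ltn_ceil (u * n) a0.
have hy := leq_divM (v * n) b; have hy' := ltn_ceil (v * n) b0.
set x := (u * n %/ a)%N in hx hx'; set y := (v * n %/ b)%N in hy hy'.
have [w [xw wy cwn]] : exists w, [/\ (x.+1 <= w)%N, (w < y)%N & coprime w n].
  apply: coprime_in_interval => //; rewrite -/k; move: (4 ^ k)%N k0 big => K k0 big.
  have ab0 : (0 < a * b)%N by rewrite muln_gt0 a0.
  have : (a * b * (x + 2 * K + 2) < a * b * y.+1)%N; last first.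
    by rewrite ltn_pmul2l //; lia.
  have h1 : (a * b * x <= b * (u * n))%N.
    by rewrite [(a * b)%N]mulnC -mulnA leq_mul2l [(a * x)%N]mulnC hx orbT.
  have h2 : (a * (v * n) < a * b * y.+1)%N.
    by rewrite -mulnA ltn_pmul2l // [(b * _)%N]mulnC.
  have h3 : (a * (v * n) = b * (u * n) + n)%N.
    by rewrite mulnA [(a * v)%N]mulnC bez; lia.
  have h4 : (a * b * (2 * K + 2) <= n)%N.
    apply: leq_trans big; rewrite [(4 * _)%N]mulnC -(mulnA (a * b)) leq_mul2l; lia.
  by rewrite -addnA mulnDr; lia.
(* [le1] and [le2] make the truncated subtractions in the witnesses exact. *)
have le1 : (b * w <= v * n)%N.
  by apply: leq_trans hy; rewrite mulnC leq_mul2r ltnW ?orbT.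
have le2 : (u * n <= a * w)%N.
  apply: leq_trans (ltnW hx') _; by rewrite mulnC leq_mul2l xw orbT.
exists (v * n - b * w)%N, (a * w - u * n)%N.
have en : n = (a * (v * n - b * w) + b * (a * w - u * n))%N.
  rewrite !mulnBr.
  have := leq_mul (leqnn a) le1; have := leq_mul (leqnn b) le2.
  have e1 : (a * (v * n) = b * (u * n) + n)%N.
    by rewrite mulnA [(a * v)%N]mulnC bez; lia.
  have e2 : (a * (b * w) = b * (a * w))%N by rewrite mulnCA.
  lia.
have ew : w = (u * (v * n - b * w) + v * (a * w - u * n))%N.
  rewrite !mulnBr.
  have := leq_mul (leqnn u) le1; have := leq_mul (leqnn v) le2.
  have e1 : (v * (a * w) = u * (b * w) + w)%N by rewrite mulnA bez; lia.
  have e2 : (u * (v * n) = v * (u * n))%N by rewrite mulnCA.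
  lia.
split => //; apply: (coprime_of_combinations a b u v).
by rewrite -en -ew coprime_sym.
Qed.

(** * Integers without a coprime representation *)

Lemma not_coprime_of_smooth_multiple (a b n X x y : nat) :
  (2 < a)%N -> coprime a b -> (a %| n + b)%N -> (n < b * X.+1)%N ->
  (forall p, prime p -> (p <= X)%N -> ~~ (p %| a)%N -> (p %| n)%N) ->
  n = (a * x + b * y)%N -> ~~ coprime x y.
Proof.
move=> a2 cab abn nX smooth en.
have yX : (y <= X)%N.
  by rewrite -ltnS -(@ltn_pmul2l b); lia.
have ay : (a %| y.+1)%N.
  have : (a %| b * y.+1)%N.
    by move: abn; rewrite en -addnA -mulnSr dvdn_addr // dvdn_mulr.
  by rewrite Gauss_dvdr.
(* A divisor [a > 2] of [y + 1] excludes [y = 0] and [y = 1]. *)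
have y1 : (1 < y)%N by have := dvdn_leq (ltn0Sn y) ay; lia.
have pP := pdiv_prime y1; have py := pdiv_dvd y.
(* A common prime of [y] and [a] would divide both [y] and [y + 1]. *)
have npa : ~~ (pdiv y %| a)%N.
  apply/negP => /dvdn_trans/(_ ay); rewrite -addn1 dvdn_addr //.
  by rewrite dvdn1 => /eqP p1; rewrite p1 in pP.
have := smooth _ pP (leq_trans (pdiv_leq (ltnW y1)) yX) npa.
rewrite en (dvdn_addl _ (dvdn_mull _ py)) Euclid_dvdM // (negPf npa) /= => px.
apply/negP => /eqP cxy; have : (pdiv y %| gcdn x y)%N by rewrite dvdn_gcd px.
by rewrite cxy dvdn1 => /eqP p1; rewrite p1 in pP.
Qed.

(** The prime [p] divides the factorial of [m + m] but not that of [m]. *)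
Lemma prime_dvd_central_bin (m p : nat) :
  prime p -> (m < p)%N -> (p <= m + m)%N -> (p %| 'C(m + m, m))%N.
Proof.
move=> pP mp pmm; have := bin_fact (leq_addr m m); rewrite addnK => efact.
have ndvd k : (k < p)%N -> ~~ (p %| k`!)%N.
  elim: k => [|k IH] kp; first by rewrite fact0 dvdn1; case: eqP pP => // ->.
  by rewrite factS Euclid_dvdM // negb_or IH 1?ltnW // andbT gtnNdvd.
have : (p %| (m + m)`!)%N by rewrite dvdn_fact // prime_gt0.
by rewrite -efact !Euclid_dvdM // (negPf (ndvd m mp)) !orbF.
Qed.

(** Chebyshev's doubling argument: the primes in [(m, 2m]] divide a central binomial coefficient,
    itself at most [4 ^ m]. Powers of 2 keep the halving exact. *)
Lemma primorial_pow2_bound (j : nat) :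
  (\prod_(0 <= p < (2 ^ j).+1 | prime p) p <= 4 ^ (2 ^ j))%N.
Proof.
elim: j => [|j IH]; first by rewrite expn0 unlock.
set m := (2 ^ j)%N in IH *.
rewrite expnS mul2n -addnn -/m (@big_cat_nat _ _ _ m.+1) //=; last first.
  by rewrite ltnS leq_addr.
rewrite expnD leq_mul //.
have bin_le : ('C(m + m, m) <= 4 ^ m)%N.
  rewrite -[4%N]/(2 ^ 2)%N -expnM mul2n -addnn (expnDn 1 1).
  rewrite (bigD1 (inord m)) //= inordK ?ltnS ?leq_addr // !exp1n !muln1.
  exact: leq_addr.
apply: leq_trans bin_le; apply: dvdn_leq; first by rewrite bin_gt0 leq_addr.
rewrite -big_filter; apply: prod_primes_dvd.
- by rewrite filter_uniq ?iota_uniq.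
- exact: filter_all.
- apply/allP => p; rewrite mem_filter mem_index_iota => /and3P[pP mp pm].
  exact: prime_dvd_central_bin.
Qed.

Lemma nonrepresentable_witness (a j : nat) : (2 < a)%N ->
  let X := (2 ^ j.+1)%N in
  exists b n : nat, [/\ coprime a b, (X < b)%N, (b * X <= 2 * n)%N,
    (b <= (4 * a.+1) ^ X)%N &
    forall x y : nat, n = (a * x + b * y)%N -> ~~ coprime x y].
Proof.
move=> a2 X; pose M := (\prod_(0 <= p < X.+1 | prime p && ~~ (p %| a)) p)%N.
have X2 : (2 <= X)%N by rewrite /X expnS leq_pmulr // expn_gt0.
have M0 : (0 < M)%N by apply: prodn_cond_gt0 => p /andP[/prime_gt0].
have M4 : (M <= 4 ^ X)%N.
  apply: leq_trans (primorial_pow2_bound j.+1); rewrite -/X /M big_mkcondr /=.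
  by apply: leq_prod => p /prime_gt0 p0; case: ifP.
have cM : coprime a M.
  apply: (big_ind (coprime a)); rewrite ?coprimen1 //.
    by move=> x y; rewrite coprimeMr => -> ->.
  by move=> p /andP[pP npa]; rewrite coprime_sym prime_coprime.
(* The factor [a.+1 ^ X], coprime to [a], makes [n] so large that moving [b] to the right residue
   class keeps [b * X <= 2 * n]; it also forces [X < b]. *)
pose n := (M * a.+1 ^ X)%N.
have cn : coprime a n.
  by rewrite coprimeMr cM coprimeXr // coprimenS.
have nX : (a.+1 ^ X <= n)%N by rewrite leq_pmull.
have powX : (a.+1 * X <= a.+1 ^ X)%N.
  elim: (X) => [|[|k] IH]; rewrite ?muln0 ?muln1 ?expn1 //.
  rewrite expnS; apply: leq_trans (leq_mul (leqnn _) IH); lia.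
(* [b] is the least integer above [q] with [b = - n] modulo [a] *)
pose q := (n %/ X).+1; pose b := (q + (a - (n + q) %% a))%N.
have a0 : (0 < a)%N by lia.
have X0 : (0 < X)%N by lia.
have abn : (a %| n + b)%N.
  rewrite /b addnA {1}(divn_eq (n + q) a) -addnA subnKC ?(ltnW (ltn_pmod _ a0)) //.
  by rewrite dvdn_addl ?dvdn_mull.
(* A common divisor of [a] and [b] divides [n + b], hence [n], which is coprime to [a]. *)
have cab : coprime a b.
  rewrite /coprime -dvdn1 -(eqP cn) dvdn_gcd dvdn_gcdl /=.
  by rewrite -(@dvdn_addl b) ?dvdn_gcdr // (dvdn_trans (dvdn_gcdl a b)).
have bX : (b * X <= 2 * n)%N.
  have := leq_divM n X; have : (b <= n %/ X + a.+1)%N by rewrite /b /q; lia.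
  by move=> h1 h2; have := leq_mul h1 (leqnn X); rewrite mulnDl; lia.
have nbX : (n < b * X)%N.
  apply: leq_trans (ltn_ceil n X0) _; rewrite leq_mul2r /b /q; lia.
exists b, n; split => //.
- rewrite -(@ltn_pmul2r X) //; apply: leq_trans nbX; rewrite ltnS.
  apply: leq_trans nX.
  apply: leq_trans (_ : (4 ^ X <= _)%N); last by rewrite leq_exp2r; lia.
  by rewrite -[4%N]/(2 * 2)%N expnMn leq_mul // ltnW // ltn_expl.
(* [X >= 2] turns [b * X <= 2 * n] into [b <= n]. *)
- apply: leq_trans (_ : (n <= _)%N).
    by rewrite -(@leq_pmul2r X) //; apply: leq_trans bX _; rewrite mulnC leq_mul2l X2 orbT.
  by rewrite expnMn leq_mul.
move=> x y; apply: (not_coprime_of_smooth_multiple a b n X) => //.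
  by apply: leq_trans nbX _; rewrite leq_mul.
move=> p pP pX npa; apply: dvdn_mulr.
rewrite /M -big_filter (bigD1_seq p) ?filter_uniq ?iota_uniq ?dvdn_mulr //=.
by rewrite mem_filter pP npa mem_iota /= prime_gt0.
Qed.

(** * Finiteness of [G] and the limit superior *)

Lemma primitively_representable_nat (a b n : nat) :
  primitively_representable a b n%:Z <->
  exists x y : nat, coprime x y /\ n = (a * x + b * y)%N.
Proof.
split=> -[x [y [cxy en]]]; exists x, y; split=> //; last first.
  by rewrite en PoszD !PoszM.
by move: en; rewrite -!PoszM -PoszD => -[].
Qed.

Lemma G_is_least_bound (a b : nat) : (0 < a)%N -> (0 < b)%N -> coprime a b ->
  is_least_bound a b (G a b).
Proof.
move=> a0 b0 cab.
suff ex : exists g, is_least_bound a b g.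
  exact: (xgetPex 0 ex).
have [N HN] := coprime_representation_eventually a b a0 b0 cab.
(* A bound below -1 would make -1 representable. *)
have bound_ge g : all_above_representable a b g -> -1 <= g.
  move=> Hg; rewrite leNgt; apply/negP => /Hg [x [y [_]]]; lia.
(* the bounds are at least [-1]; shift by one to use well-foundedness of nat *)
pose P (k : nat) := `[< all_above_representable a b (k%:Z - 1) >].
have exP : exists k, P k.
  exists N.+1; apply/asboolP => -[] n lt_n; last by exfalso; move: lt_n; rewrite NegzE; lia.
  by apply/primitively_representable_nat/HN; lia.
case: (ex_minnP exP) => k /asboolP Pk kmin; exists (k%:Z - 1); split => // g Hg.
have g1 := bound_ge g Hg.
have /kmin : P (absz (g + 1)).
  by apply/asboolP; have -> : (absz (g + 1))%:Z - 1 = g by lia.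
lia.
Qed.

Lemma G_ge_of_nonrepresentable (a b n : nat) :
  (0 < a)%N -> (0 < b)%N -> coprime a b ->
  (forall x y : nat, n = (a * x + b * y)%N -> ~~ coprime x y) ->
  n%:Z <= G a b.
Proof.
move=> a0 b0 cab nrep; have [above _] := G_is_least_bound a b a0 b0 cab.
rewrite leNgt; apply/negP => /above/primitively_representable_nat.
by case=> x [y [cxy /nrep]]; rewrite cxy.
Qed.

Theorem theorem5 (R : realType) (a1 : nat) (ha1 : (2 < a1)%N) :
  exists c1 : R, 0 < c1 /\
    (c1%:E < limf_esup
       (fun a2 : nat => ((G a1 a2)%:~R / (a2%:R * ln (a2%:R : R)))%:E)
       (within [set a2 : nat | coprime a1 a2] \oo))%E.
Proof.
pose K : R := ln (4 * a1.+1)%:R.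
have K0 : 0 < K by rewrite ln_gt0 // (ltr_nat _ 1); lia.
(* The ratio will be shown to reach [1 / (2 * K)] at the witnesses; halving this makes the
   inequality strict. *)
exists (4 * K)^-1; split; first by rewrite invr_gt0 mulr_gt0.
apply: (@lt_le_trans _ _ ((2 * K)^-1)%:E).
  by rewrite lte_fin ltf_pV2 ?posrE ?mulr_gt0 // ltr_pM2r // ltr_nat.
(* The limit superior is an infimum of suprema over sets [V] containing all large [a2] coprime to
   [a1], so one witness in each [V] suffices. *)
apply: le_ereal_inf_tmp => _ [V VF <-].
have [N _ HN] : \forall a2 \near \oo, coprime a1 a2 -> V a2 := VF.
(* With [j = N], [b > 2 ^ N.+1 > N] puts [b] in [V]. *)
have [b [n [cab Xb bX bpow nrep]]] := nonrepresentable_witness a1 N ha1.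
set X := (2 ^ N.+1)%N in Xb bX bpow.
have X0 : (0 < X)%N by rewrite expn_gt0.
have Vb : V b.
  apply: HN => //=; apply: ltnW; apply: leq_trans Xb.
  by apply: ltnW; rewrite ltnS; apply: leq_trans (ltnW (ltn_expl N.+1 (ltnSn 1))).
apply: le_trans (ereal_sup_ubound (_ : _ ((G a1 b)%:~R / (b%:R * ln b%:R))%:E)); last first.
  by exists b.
have b1 : (1 < b)%N by apply: leq_trans Xb; rewrite ltnS.
have br : 0 < b%:R :> R by rewrite ltr0n; lia.
have lnb : 0 < ln b%:R :> R by rewrite ln_gt0 // (ltr_nat _ 1).
have lnle : ln b%:R <= X%:R * K.
  rewrite mulr_natl /K -lnXn ?ltr0n ?muln_gt0 //.
  by rewrite ler_ln ?posrE ?exprn_gt0 ?ltr0n ?(ltnW b1) // -natrX ler_nat.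
have Gn : n%:R <= (G a1 b)%:~R :> R.
  rewrite -[n%:R]/(n%:Z%:~R) ler_int; apply: G_ge_of_nonrepresentable => //; lia.
rewrite lee_fin ler_pdivlMr ?mulr_gt0 //; apply: le_trans Gn.
rewrite mulrC ler_pdivrMr ?mulr_gt0 //.
have h : b%:R * X%:R <= 2 * n%:R :> R by rewrite -!natrM ler_nat.
apply: le_trans (_ : b%:R * (X%:R * K) <= _).
  by rewrite ler_pM2l.
by rewrite mulrA [n%:R * _]mulrA ler_pM2r // [n%:R * _]mulrC.
Qed.
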